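(* Let $p>3$ be a prime and let $G$ be a finite $p$-group that is nilpotent of class $\le 3$. Let $g_1,\ldots,g_n$ be a polycyclic generating sequence of $G$. Suppose that all nontrivial commutators $[g_i,g_j]$, where $i>j$, are different absolute elements of the polycyclic generating sequence (that is, each nontrivial $[g_i,g_j]$ with $i>j$ equals some absolute element $g_k$ of the sequence, and distinct pairs $(i,j)$, $i>j$, with nontrivial commutators give different elements of the sequence). Then $\mathrm{B}_0(G)=0$.
   Context: For a finite group $G$, the Bogomolov multiplier (unramified Brauer group) of $G$ is $$\mathrm{B}_0(G)=\bigcap_{A\le G,\ A\text{ abelian}}\ker\bigl(\mathrm{res}^G_A:\mathrm{H}^2(G,\mathbb{Q}/\mathbb{Z})\to \mathrm{H}^2(A,\mathbb{Q}/\mathbb{Z})\bigr),$$ where $\mathrm{res}^G_A$ is the cohomological restriction map and $\mathbb{Q}/\mathbb{Z}$ carries the trivial action. Commutators are $[x,y]=x^{-1}y^{-1}xy$. A polycyclic generating sequence of a finite solvable group $G$ is a sequence $g_1,\ldots,g_n$ of elements of $G$ for which there is a subnormal series $G=G_1\triangleright G_2\triangleright\cdots\triangleright G_{n+1}=1$ with every factor $G_i/G_{i+1}$ cyclic of order $r_i$ and $G_i=\langle G_{i+1},g_i\rangle$ for all $1\le i\le n$. The number $r_i$ is the relative order of $g_i$. The element $g_i$ of the sequence is called absolute if its relative order $r_i$ is equal to the order of $g_i$ in $G$. *)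

(* Defs.v *)
From HB Require Import structures.
From mathcomp Require Import all_boot all_order all_algebra.
From mathcomp Require Import all_fingroup all_solvable.
From mathcomp Require Import generic_quotient ring_quotient.
From mathcomp Require Import boolp classical_sets.

Set Implicit Arguments.
Unset Strict Implicit.
Unset Printing Implicit Defensive.

Import GRing.Theory.

Local Open Scope ring_scope.
Local Open Scope quotient_scope.

Definition int_closed : zmodClosed rat :=
  GRing.ZmodClosed.clone rat (@Num.int_num_subdef rat) _.

Definition QmodZ : zmodType := {ideal_quot int_closed}.

Lemma QmodZ_eqE (x y : rat) :
  (\pi_{ideal_quot int_closed} x == \pi_{ideal_quot int_closed} y)
  = (x - y \is a Num.int).
Proof. by rewrite -Quotient.idealrBE. Qed.

Section SecondCohomology.

(* Inhomogeneous cochains; the coefficient group M has the trivial action. *)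
Variables (gT : finGroupType) (M : zmodType).

Definition cochain2 := {ffun gT * gT -> M}.

Definition cocycle2 : {pred cochain2} :=
  fun f => [forall x, forall y, forall z,
    f (y, z) - f ((x * y)%g, z) + f (x, (y * z)%g) - f (x, y) == 0].

Lemma cocycle2P (f : cochain2) :
  reflect (forall x y z, f (y, z) - f ((x * y)%g, z) + f (x, (y * z)%g)
                           - f (x, y) = 0)
          (f \in cocycle2).
Proof.
apply: (iffP forallP) => [Hf x y z | Hf x].
  by have /forallP/(_ y)/forallP/(_ z)/eqP := Hf x.
by apply/forallP => y; apply/forallP => z; apply/eqP.
Qed.

Fact cocycle2_closed : zmod_closed cocycle2.
Proof.
split=> [|f g /cocycle2P Hf /cocycle2P Hg]; apply/cocycle2P => x y z.
  by rewrite !ffunE subrr addr0 subrr.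
have := congr2 (fun a b => a - b) (Hf x y z) (Hg x y z).
rewrite subr0 => <-; rewrite !ffunE !opprD !opprK.
by rewrite (AC (2*2*2*2) ((1*3*5*7)*(2*4*6*8)))/= .
Qed.

HB.instance Definition _ :=
  GRing.isZmodClosed.Build cochain2 cocycle2 cocycle2_closed.

Record Z2 := MkZ2 { Z2val :> cochain2; Z2valP : Z2val \in cocycle2 }.

HB.instance Definition _ := [isSub for Z2val].
HB.instance Definition _ := [Choice of Z2 by <:].
HB.instance Definition _ := [SubChoice_isSubZmodule of Z2 by <:].

Definition coboundary1 (h : gT -> M) : cochain2 :=
  [ffun u => h u.2 - h (u.1 * u.2)%g + h u.1].

Definition B2 : {pred Z2} :=
  fun f => `[< exists h : gT -> M, Z2val f = coboundary1 h >].

Lemma B2P (f : Z2) :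
  reflect (exists h : gT -> M, Z2val f = coboundary1 h) (f \in B2).
Proof. exact: asboolP. Qed.

Fact B2_closed : zmod_closed B2.
Proof.
split=> [|f g /B2P[h Hh] /B2P[k Hk]]; apply/B2P.
  exists (fun=> 0); apply/ffunP => u.
  by rewrite !ffunE subrr addr0.
exists (fun x => h x - k x); rewrite [LHS]/= Hh Hk.
apply/ffunP => u; rewrite !ffunE !opprD !opprK.
by rewrite (AC (3*3) ((1*4)*(2*5)*(3*6)))/= .
Qed.

HB.instance Definition _ := GRing.isZmodClosed.Build Z2 B2 B2_closed.

Definition H2 : zmodType := {ideal_quot (GRing.ZmodClosed.clone Z2 B2 _)}.

End SecondCohomology.

Section Restriction.

Variables (gT : finGroupType) (M : zmodType) (A : {group gT}).

Definition res_cochain (f : cochain2 gT M) : cochain2 (subg_of A) M :=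
  [ffun u => f (sgval u.1, sgval u.2)].

Fact res_cocycle (f : Z2 gT M) : res_cochain f \in @cocycle2 (subg_of A) M.
Proof.
apply/cocycle2P => x y z; rewrite !ffunE /=.
exact: (cocycle2P _ (Z2valP f)).
Qed.

Definition resZ2 (f : Z2 gT M) : Z2 (subg_of A) M := MkZ2 (res_cocycle f).

Definition res2 (c : H2 gT M) : H2 (subg_of A) M :=
  \pi_(H2 (subg_of A) M) (resZ2 (repr c)).

Fact resZ2_is_zmod_morphism : zmod_morphism resZ2.
Proof. by move=> f g; apply: val_inj; apply/ffunP => u; rewrite !ffunE. Qed.

HB.instance Definition _ :=
  GRing.isZmodMorphism.Build (Z2 gT M) (Z2 (subg_of A) M) resZ2
    resZ2_is_zmod_morphism.

Fact resZ2_B2 (f : Z2 gT M) : f \in @B2 gT M -> resZ2 f \in @B2 (subg_of A) M.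
Proof.
case/B2P=> h Hh; apply/B2P; exists (fun x => h (sgval x)).
by apply/ffunP => u; rewrite !ffunE Hh !ffunE.
Qed.

(* res2 does not depend on the chosen representative. *)
Lemma res2E (f : Z2 gT M) :
  res2 (\pi_(H2 gT M) f) = \pi_(H2 (subg_of A) M) (resZ2 f).
Proof.
apply/eqP; rewrite -Quotient.idealrBE -raddfB.
by apply: resZ2_B2; rewrite Quotient.idealrBE reprK.
Qed.

Fact res2_is_zmod_morphism : zmod_morphism res2.
Proof.
move=> c d; rewrite -[c]reprK -[d]reprK -raddfB !res2E.
by rewrite !raddfB.
Qed.

HB.instance Definition _ :=
  GRing.isZmodMorphism.Build (H2 gT M) (H2 (subg_of A) M) res2
    res2_is_zmod_morphism.

End Restriction.

Definition bogomolov (gT : finGroupType) : set (H2 gT QmodZ) :=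
  (\bigcap_(A in [set A : {group gT} | abelian A])
     [set c | res2 A c = 0])%classic.

Arguments bogomolov gT : clear implicits.

Section PolycyclicSequences.

Local Open Scope group_scope.

Variables (gT : finGroupType) (G : {group gT}).
Variables (n : nat) (g : 'I_n -> gT) (Gs : nat -> {group gT}).

(* Indices start at 0: g i generates Gs i over Gs i.+1, and only the terms
   Gs 0, ..., Gs n matter. *)
Definition pc_sequence : Prop :=
  [/\ Gs 0%N = G, Gs n = 1%G &
      forall i : 'I_n,
        [/\ Gs i.+1 <| Gs i, cyclic (Gs i / Gs i.+1)
          & Gs i :=: <<g i |: Gs i.+1>>]].

Definition relative_order (i : 'I_n) : nat := #|Gs i / Gs i.+1|.

Definition absolute (i : 'I_n) : Prop := relative_order i = #[g i].

End PolycyclicSequences.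

(* Main.v *)
(* A class in B_0(G) is represented by a cocycle f that is symmetric on
   commuting pairs, so in the central extension E of G by Q/Z defined by f any
   two elements with commuting images commute. In particular [E, E] is abelian,
   lifts of elements of the third term of the lower central series are central,
   and [E, E] is generated by the commutators of lifts of the g_i. Each of these
   has the same order as its image, which is an absolute element g_k; as
   distinct absolute g_k are independent in the abelian group [G, G], it follows that
   [E, E] meets Q/Z trivially. A maximal subgroup that contains [E, E] and meets
   Q/Z trivially is a complement of Q/Z because Q/Z is divisible, so f is a
   coboundary. *)

From HB Require Import structures.
Require Import Defs.
From mathcomp Require Import all_boot all_order all_algebra.
From mathcomp Require Import all_fingroup all_solvable.
From mathcomp Require Import generic_quotient ring_quotient.
From mathcomp Require Import boolp classical_sets.

Set Implicit Arguments.
Unset Strict Implicit.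
Unset Printing Implicit Defensive.

Local Open Scope group_scope.

(** * Commutator identities in arbitrary, possibly infinite, groups *)

Section GroupCommutators.

Variable E : groupType.
Implicit Types x y z : E.

Lemma group_conjg_mulR x y : x * [~ x, y] = x ^ y.
Proof. by rewrite commgEl mulVKg. Qed.

Lemma group_commMgR x y z : [~ x * y, z] = [~ x, z] * [~ x, z, y] * [~ y, z].
Proof.
have -> : [~ x * y, z] = [~ x, z] ^ y * [~ y, z].
  by rewrite !commgEr conjgM mulgA -conjMg mulgK.
by rewrite group_conjg_mulR.
Qed.

Lemma group_expMg_Rmul x y i : commute y [~ y, x] -> commute x [~ y, x] ->
  (x * y) ^+ i = x ^+ i * y ^+ i * [~ y, x] ^+ 'C(i, 2).
Proof.
have := commgC y x; move: [~ y, x] => z yx cyz cxz.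
(* Moving [x] to the left past [y ^+ k] costs [z ^+ k]; these costs add up to the exponent
   ['C(i, 2)]. *)
have cyX k : y ^+ k * x = x * y ^+ k * z ^+ k.
  elim: k => [|k IHk]; first by rewrite !expg0 mul1g !mulg1.
  rewrite expgS -mulgA IHk !mulgA yx (expgS z).
  by rewrite -!mulgA [z * (_ * _)]mulgA (commuteX k (commute_sym cyz)) !mulgA.
elim: i => [|i IHi]; first by rewrite !expg0 !mulg1.
have czM : commute (z ^+ 'C(i, 2)) (x * y).
  by apply/commute_sym/commuteX/commute_sym/commuteM; apply: commute_sym.
rewrite expgSr IHi -mulgA czM !mulgA binS bin1 addnC expgnDr mulgA.
congr (_ * _); rewrite -[x ^+ i * _ * x]mulgA cyX !expgSr -!mulgA.
by congr (_ * (_ * (_ * _))); apply/commute_sym/commuteX.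
Qed.

Lemma group_commXg x y i : commute x [~ x, y] ->
  [~ x ^+ i, y] = [~ x, y] ^+ i.
Proof.
move=> cxc; rewrite commgEl conjXg.
by rewrite -group_conjg_mulR expgMn // mulKg.
Qed.

End GroupCommutators.

(** In a finite group, closure under products makes the elements of [<<A>>] that satisfy [P] a
    subgroup. *)
Lemma gen_ind (gT : finGroupType) (A : {set gT}) (P : gT -> Prop) :
    P 1 ->
    (forall a b, a \in <<A>> -> b \in <<A>> -> P a -> P b -> P (a * b)) ->
    (forall a, a \in A -> P a) ->
  forall a, a \in <<A>> -> P a.
Proof.
move=> P1 PM PA.
have gK : group_set [set a in <<A>> | `[< P a >]].
  apply/group_setP; split=> [|a b].
    by rewrite finset.in_set group1; apply/asboolP.
  rewrite !finset.in_set => /andP[Aa /asboolP Pa] /andP[Ab /asboolP Pb].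
  by rewrite groupM //; apply/asboolP/PM.
move=> a Aa; have: a \in Group gK.
  move: a Aa; apply/fintype.subsetP; rewrite gen_subG.
  apply/fintype.subsetP=> a Aa.
  by rewrite finset.in_set mem_gen //; apply/asboolP/PA.
by rewrite finset.in_set => /andP[_ /asboolP].
Qed.

(** * Polycyclic generating sequences *)

Section PolycyclicSequenceTheory.

Variables (gT : finGroupType) (G : {group gT}).
Variables (n : nat) (g : 'I_n -> gT) (Gs : nat -> {group gT}).
Hypothesis gS : pc_sequence G g Gs.

Lemma pc_gen k : (k <= n)%N ->
  Gs k = <<[set g j | j : 'I_n & (k <= j)%N]>> :> {set gT}.
Proof.
have [_ Gsn GsP] := gS.
move=> le_kn; rewrite -(subKn le_kn).
elim: (n - k)%N (leq_subr k n) => [|d IHd].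
  rewrite subn0 Gsn => _.
  suff -> : [set g j | j : 'I_n & (n <= j)%N] = finset.set0 by rewrite gen0.
  apply/finset.setP=> a; rewrite finset.in_set0; apply/negbTE/negP.
  by case/imsetP=> j; rewrite finset.in_set leqNgt ltn_ord.
move=> lt_dn; have {IHd}IH := IHd (ltnW lt_dn).
have lt_in : (n - d.+1 < n)%N by rewrite ltn_subrL (leq_ltn_trans _ lt_dn).
pose i := Ordinal lt_in; have [_ _] := GsP i; rewrite /= subnSK // => ->.
apply/eqP; rewrite finset.eqEsubset !gen_subG; apply/andP; split.
  rewrite finset.subUset finset.sub1set; apply/andP; split.
    by rewrite mem_gen //; apply/imsetP; exists i; rewrite ?finset.in_set.
  rewrite IH genS //; apply/fintype.subsetP=> _ /imsetP[j + ->].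
  rewrite finset.in_set => le_j; apply: imset_f.
  by rewrite finset.in_set (leq_trans _ le_j) // leq_sub2l.
apply/fintype.subsetP=> _ /imsetP[j + ->]; rewrite finset.in_set => le_j.
rewrite mem_gen // finset.in_setU finset.in_set1.
move: le_j; rewrite leq_eqVlt => /orP[/eqP ij|lt_ij].
  by apply/orP; left; apply/eqP; congr g; apply: val_inj.
apply/orP; right; rewrite IH mem_gen //; apply: imset_f.
by rewrite finset.in_set -subnSK.
Qed.

(** The coset of [g k] generates [Gs k / Gs k.+1], so by absoluteness it has the same order as
    [g k]. *)
Lemma absolute_expg (k : 'I_n) m :
  absolute g Gs k -> g k ^+ m \in Gs k.+1 -> g k ^+ m = 1.
Proof.
have [_ _ /(_ k)[nsN _ genH]] := gS.
have Hg : g k \in Gs k by rewrite genH mem_gen // finset.setU11.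
have Ng : g k \in 'N(Gs k.+1).
  by apply: fintype.subsetP Hg; apply: normal_norm.
rewrite /absolute /relative_order => ordE gm.
have GsE : Gs k / Gs k.+1 = <[coset (Gs k.+1) (g k)]>.
  have nN : (g k |: Gs k.+1)%SET \subset 'N(Gs k.+1).
    by rewrite finset.subUset finset.sub1set Ng normG.
  rewrite genH quotient_gen // quotientU quotientE morphim_set1 //.
  by rewrite trivg_quotient -[LHS]/(_ <*> 1) -joing_idl joingG1.
suff: (#[g k] %| m)%N by rewrite order_dvdn => /eqP.
rewrite -ordE GsE -orderE.
by rewrite order_dvdn -morphX //= coset_id.
Qed.

End PolycyclicSequenceTheory.

(** * Extensions with divisible kernel in which elements with commuting images commute *)

Section CPExtension.

Variables (E : groupType) (gT : finGroupType) (pi : UMagmaMorphism.type E gT).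
Hypothesis pi_surj : forall a, exists u, pi u = a.
Hypothesis cpE : forall u v, commute (pi u) (pi v) -> commute u v.
Hypothesis ker_divisible : forall z m, (0 < m)%N -> pi z = 1 ->
  exists2 d, pi d = 1 & d ^+ m = z.

Implicit Types (u v w : E) (S D : E -> Prop).

Lemma ker_central z u : pi z = 1 -> commute z u.
Proof. by move=> z1; apply: cpE; rewrite z1; apply/commute_sym/commute1. Qed.

(** Two lifts of one element differ by a factor in the kernel, which is central. *)
Lemma commg_lift u v u' v' :
  pi u = pi u' -> pi v = pi v' -> [~ u, v] = [~ u', v'].
Proof.
have kill_l (z x y : E) : pi z = 1 -> [~ z * x, y] = [~ x, y].
  move=> z1; have zy1 : [~ z, y] = 1 by apply/eqP/commgP/ker_central.
  by rewrite group_commMgR zy1 comm1g !mul1g.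
have kill (x x' y : E) : pi x = pi x' -> [~ x, y] = [~ x', y].
  move=> eqx; rewrite -(kill_l (x' * x^-1)) ?mulgVK //.
  by rewrite gmulfM gmulfV eqx mulgV.
by move=> equ eqv; rewrite (kill _ _ _ equ) -invgR (kill _ _ _ eqv) invgR.
Qed.

(** Such an [S] is a subgroup meeting the kernel trivially: [u ^+ #[pi u]] lies in [S] and in the
    kernel, hence is 1, so the inverse of [u] is a power of [u]. *)
Definition partial_section S : Prop :=
  [/\ S 1, forall u v, S u -> S v -> S (u * v)
    & forall u, S u -> pi u = 1 -> u = 1].

Lemma partial_sectionX S u k : partial_section S -> S u -> S (u ^+ k).
Proof.
case=> S1 SM _ Su; elim: k => [|k IHk]; first by rewrite expg0.
by rewrite expgS; apply: SM.
Qed.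

Lemma partial_sectionV S u : partial_section S -> S u -> S u^-1.
Proof.
move=> psS Su; case: (psS) => _ _ S_inj.
have u1: u ^+ #[pi u] = 1.
  apply: S_inj; first exact: partial_sectionX.
  by rewrite gmulfXn expg_order.
suff -> : u^-1 = u ^+ #[pi u].-1 by apply: partial_sectionX.
by apply: mulg1_eq; rewrite -expgS prednK ?order_gt0.
Qed.

(* Let m > 0 be least such that a^m lifts to some u in S. By divisibility of the
   kernel, a has a lift x with x^m = u; then S<x> still meets the kernel
   trivially. *)
Lemma partial_section_extend S (a : gT) :
    partial_section S -> (forall u v, S [~ u, v]) ->
  exists S', [/\ partial_section S', forall u, S u -> S' u
               & exists2 u, S' u & pi u = a].
Proof.
move=> psS Scomm; case: (psS) => S1 SM S_inj.
have SV u : S u -> S u^-1 := @partial_sectionV S u psS.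
have SX u k : S u -> S (u ^+ k) := @partial_sectionX S u k psS.
have [x0 x0a] := pi_surj a.
pose P m := (0 < m)%N && `[< exists2 u, S u & pi u = a ^+ m >].
have exP : exists m, P m.
  exists #[a]; rewrite /P order_gt0; apply/asboolP.
  by exists 1; rewrite ?gmulf1 ?expg_order.
case: (ex_minnP exP) => m /andP[m_gt0 /asboolP[u Su pu]] m_min {exP}.
have [d d1 dm] : exists2 d, pi d = 1 & d ^+ m = (x0 ^+ m)^-1 * u.
  by apply: ker_divisible => //; rewrite gmulfM gmulfV gmulfXn x0a pu mulVg.
pose x := x0 * d; have px : pi x = a by rewrite gmulfM x0a d1 mulg1.
have xm : x ^+ m = u.
  by rewrite expgMn ?dm ?mulVKg //; apply/commute_sym/ker_central.
exists (fun v => exists s k, S s /\ v = s * x ^+ k); split; last 1 first.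
- by exists x => //; exists 1, 1%N; rewrite mul1g.
- split.
  + by exists 1, 0%N; rewrite mul1g.
  + move=> _ _ [s [k [Ss ->]]] [t [l [St ->]]].
    (* Moving [x ^+ k] to the right past [t] conjugates [t] by [(x ^+ k)^-1]; the result stays in
       [S] because [S] contains all commutators. *)
    exists (s * (t * [~ t, (x ^+ k)^-1])), (k + l)%N; split.
      by apply: (SM _ _ Ss (SM _ _ St (Scomm _ _))).
    by rewrite commgEl mulVKg /conjg invgK expgnDr !mulgA mulgVK.
  move=> _ [s [k [Ss ->]]]; rewrite gmulfM gmulfXn px => sk1.
  have ak : a ^+ k = pi s^-1.
    by rewrite gmulfV; apply/esym/mulg1_eq.
  have eqk := divn_eq k m.
  (* A nonzero remainder would give [a ^+ (k %% m)] a lift in [S], against the minimality of [m]. *)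
  suff r0 : k %% m = 0%N.
    apply: S_inj; last by rewrite gmulfM gmulfXn px.
    rewrite eqk r0 addn0 mulnC expgnA xm.
    exact: SM _ _ Ss (SX _ _ Su).
  apply: contraTeq (ltn_pmod k m_gt0); rewrite -lt0n -leqNgt => r_gt0.
  apply: m_min; rewrite /P r_gt0; apply/asboolP.
  exists ((u ^+ (k %/ m))^-1 * s^-1).
    exact: SM _ _ (SV _ (SX _ _ Su)) (SV _ Ss).
  rewrite gmulfM -ak gmulfV gmulfXn pu -expgnA [in a ^+ k]eqk expgnDr.
  by rewrite [(k %/ m * m)%N]mulnC mulKg.
by move=> v Sv; exists v, 0%N; rewrite mulg1.
Qed.

(** Induction on the number of elements outside the image of [S]: each extension adds a missing one
    and keeps all commutators. *)
Lemma full_section S :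
    partial_section S -> (forall u v, S [~ u, v]) ->
  exists2 S', partial_section S' & forall a, exists2 u, S' u & pi u = a.
Proof.
pose im S := [set a | `[< exists2 u, S u & pi u = a >]].
have [m le_m] := ubnP #|~: im S|; elim: m S le_m => // m IHm S le_m psS Scomm.
have [all_im|] := pselect (forall a, a \in im S).
  by exists S => // a; have := all_im a; rewrite finset.in_set => /asboolP.
move/existsNP=> [a /negP im'a].
have [S' [psS' sSS' [u S'u pu]]] := partial_section_extend a psS Scomm.
apply: (IHm S') => //; last by move=> v w; apply: sSS'.
rewrite ltnS in le_m; apply: leq_trans le_m; apply: proper_card.
apply/properP; split.
  rewrite finset.setCS; apply/fintype.subsetP=> b.
  rewrite !finset.in_set => /asboolP[v Sv pv].
  by apply/asboolP; exists v; first exact: sSS'.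
exists a; first by rewrite finset.in_set.
by rewrite finset.in_setC negbK finset.in_set; apply/asboolP; exists u.
Qed.

(* With c = [u, v] and t = [c, u], the image of t is central, so t itself is;
   then t^m = [c^m, u] = 1 and [u^m, v] = c^m t^(m choose 2) = c^m. The latter
   maps to 1, so u^m and v have commuting images and therefore commute. *)
Lemma commg_order u v m :
    odd m -> (forall a, commute [~ pi u, pi v, pi u] a) ->
  [~ pi u, pi v] ^+ m = 1 -> [~ u, v] ^+ m = 1.
Proof.
move=> odd_m ct cm1; set c := [~ u, v]; set t := [~ c, u].
have pc : pi c = [~ pi u, pi v] by rewrite gmulfR.
have pcm : pi (c ^+ m) = 1 by rewrite gmulfXn pc.
have t_central w : commute t w by apply: cpE; rewrite gmulfR pc.
have tm : t ^+ m = 1.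
  rewrite -group_commXg; last exact/commute_sym.
  exact/eqP/commgP/ker_central.
have ucm : [~ u ^+ m, v] = c ^+ m.
  rewrite commgEl conjXg.
  rewrite -group_conjg_mulR group_expMg_Rmul; try exact/commute_sym.
  (* As [m] is odd, it divides ['C(m, 2)]. *)
  rewrite -/t -mulgA mulKg bin2odd // expgnA tm.
  by rewrite expg1n mulg1.
rewrite -/c -ucm; apply/eqP/commgP/cpE/commgP/eqP.
by rewrite -gmulfR ucm.
Qed.

(** Induction over [<<A>>] using [[uw, x] = [u, x] [u, x, w] [w, x]]. If [[u, x]] maps into [B], the
    middle factor is the inverse of [[w, [u, x]]], which the induction hypothesis for [w] covers;
    otherwise [D] holds for it directly. *)
Lemma commg_gen (A B : {set gT}) D :
    D 1 -> (forall u v, D u -> D v -> D (u * v)) ->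
    (forall u, D u -> D u^-1) ->
    (forall u x w, pi u \in <<A>> -> pi x \in B -> pi w \in <<A>> ->
       pi [~ u, x] \in B \/ D [~ u, x, w]) ->
    (forall u x, pi u \in A -> pi x \in B -> D [~ u, x]) ->
  forall u x, pi u \in <<A>> -> pi x \in B -> D [~ u, x].
Proof.
move=> D1 DM DV DR DA.
suff main a : a \in <<A>> ->
    forall u, pi u = a -> forall x, pi x \in B -> D [~ u, x].
  by move=> u x Au; apply: main Au _ _ _.
move: a; apply: gen_ind.
- move=> u u1 x _; suff -> : [~ u, x] = 1 by [].
  exact/eqP/commgP/ker_central.
- move=> a b Aa Ab Da Db u uab x Bx.
  have [w wb] := pi_surj b.
  have pv : pi (u * w^-1) = a by rewrite gmulfM gmulfV uab wb mulgK.
  rewrite -(mulgVK w u) group_commMgR.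
  apply: DM (DM _ _ (Da _ pv _ Bx) _) (Db _ wb _ Bx).
  have := DR (u * w^-1) x w; rewrite pv wb => /(_ Aa Bx Ab)[BR|//].
  by rewrite -invgR; apply/DV/Db.
- by move=> a Aa u ua x Bx; apply: DA; rewrite ?ua.
Qed.

(** * Commutators of lifts along a polycyclic generating sequence *)

Section PolycyclicSequence.

Variables (n : nat) (g : 'I_n -> gT) (Gs : nat -> {group gT}).
Hypothesis gS : pc_sequence [set: gT]%G g Gs.

(* Downward induction along the series. With N = Gs k.+1, H = Gs k and x a lift
   of g k, the commutators covered are successively those of N with x, H with
   N, H with x, and H with H; since [H, H] <= N, the correction terms in the
   expansion of a commutator of products are covered by an earlier stage. *)
Lemma commg_generated D :
    D 1 -> (forall u v, D u -> D v -> D (u * v)) ->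
    (forall u, D u -> D u^-1) ->
    (forall (i j : 'I_n) u v, (j < i)%N -> pi u = g i -> pi v = g j ->
       D [~ u, v]) ->
  forall u v, D [~ u, v].
Proof.
move=> D1 DM DV Dg.
have [GsG Gsn GsP] := gS.
have Dsym u v : D [~ u, v] -> D [~ v, u] by move/DV; rewrite invgR.
suff main d k : (k + d = n)%N ->
    forall u v, pi u \in Gs k -> pi v \in Gs k -> D [~ u, v].
  by move=> u v; apply: (main n 0%N); rewrite ?add0n // GsG finset.in_setT.
elim: d k => [|d IHd] k.
  rewrite addn0 => -> u v; rewrite Gsn => /set1P u1 _.
  suff -> : [~ u, v] = 1 by [].
  exact/eqP/commgP/ker_central.
move=> kd; have lt_kn : (k < n)%N by rewrite -kd addnS ltnS leq_addr.
pose i := Ordinal lt_kn.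
have [nsN cycHN genH] := GsP i; rewrite /= in nsN cycHN genH.
have {IHd}DNN := IHd k.+1 (etrans (addSnnS k d) kd).
have Hi : g i \in Gs k by rewrite genH mem_gen // finset.setU11.
have sNH a : a \in Gs k.+1 -> a \in Gs k.
  by apply/fintype.subsetP/normal_sub.
have RHH u v : pi u \in Gs k -> pi v \in Gs k -> pi [~ u, v] \in Gs k.+1.
  move=> Hu Hv; rewrite gmulfR.
  apply: (fintype.subsetP (der1_min (normal_norm nsN) (cyclic_abelian cycHN))).
  exact: mem_commg.
have DNx u x : pi u \in Gs k.+1 -> pi x \in [set g i] -> D [~ u, x].
  rewrite (pc_gen gS lt_kn).
  apply: (commg_gen D1 DM DV); rewrite -?(pc_gen gS lt_kn).
    move=> {}u {}x w Nu /set1P px Nw; right.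
    by apply: DNN => //; apply: RHH; [apply: sNH | rewrite px].
  move=> {}u {}x /imsetP[j]; rewrite finset.in_set => lt_kj pu /set1P px.
  exact: (Dg j i).
have DHN u v : pi u \in Gs k -> pi v \in Gs k.+1 -> D [~ u, v].
  rewrite genH; apply: (commg_gen D1 DM DV); rewrite -?genH.
    by move=> {}u x w Hu Nx Hw; left; apply: RHH => //; apply: sNH.
  move=> {}u {}v /setU1P[pu|Nu] Nv; last exact: DNN.
  by apply/Dsym/DNx => //; rewrite pu finset.set11.
have DHx u x : pi u \in Gs k -> pi x \in [set g i] -> D [~ u, x].
  rewrite genH; apply: (commg_gen D1 DM DV); rewrite -?genH.
    move=> {}u {}x w Hu /set1P px Hw; right; apply/Dsym/DHN => //.
    by apply: RHH => //; rewrite px.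
  move=> {}u {}x /setU1P[pu|Nu] xi; last exact: DNx.
  suff -> : [~ u, x] = 1 by [].
  by apply/eqP/commgP/cpE; rewrite pu (set1P xi); apply: commute_refl.
move=> u v Hu Hv; move: Hu; rewrite {1}genH => Hu; move: u v Hu Hv.
apply: (commg_gen D1 DM DV); rewrite -?genH.
  by move=> u x w Hu Hx Hw; right; apply/Dsym/DHN => //; apply: RHH.
move=> u v /setU1P[pu|Nu] Hv; apply/Dsym; last exact: DHN.
by apply: DHx => //; rewrite pu finset.set11.
Qed.

(* The products of the C k^e in increasing order of k: if such a product maps to
   1, its first factor maps into Gs k.+1, hence to 1 because g k is absolute. *)
Lemma section_of_commuting (C : 'I_n -> E) :
    (forall k l, commute (C k) (C l)) ->
    (forall k, C k = 1 \/ pi (C k) = g k /\ absolute g Gs k) ->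
    (forall k m, pi (C k) ^+ m = 1 -> C k ^+ m = 1) ->
  exists2 D, partial_section D & forall k, D (C k).
Proof.
move=> commC absC ordC.
have [GsG Gsn GsP] := gS.
(* Commuting with every [C j] is part of the invariant so that powers of the next [C i] can be
   collected on the left. *)
suff main d k : (k + d = n)%N ->
    exists D, [/\ partial_section D, forall u, D u -> pi u \in Gs k,
      forall j : 'I_n, (k <= j)%N -> D (C j)
    & forall u j, D u -> commute (C j) u].
  by have [D [psD _ DC _]] := main n 0%N (add0n n); exists D => // j; apply: DC.
elim: d k => [|d IHd] k.
  rewrite addn0 => ->; exists (fun u => u = 1); split.
  - by split=> // _ _ -> ->; rewrite mulg1.
  - by move=> _ ->; rewrite gmulf1 group1.
  - by move=> j; rewrite leqNgt ltn_ord.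
  - by move=> _ j ->; apply: commute1.
move=> kd; have lt_kn : (k < n)%N by rewrite -kd addnS ltnS leq_addr.
pose i := Ordinal lt_kn.
have [nsN _ genH] := GsP i; rewrite /= in nsN genH.
have [D [psD D_Gs DC Dcomm]] := IHd k.+1 (etrans (addSnnS k d) kd).
have [D1 DM D_inj] := psD.
have sNH a : a \in Gs k.+1 -> a \in Gs k.
  by apply/fintype.subsetP/normal_sub.
have HCi : pi (C i) \in Gs k.
  case: (absC i) => [->|[-> _]]; first by rewrite gmulf1 group1.
  by rewrite genH mem_gen // finset.setU11.
exists (fun u => exists e v, D v /\ u = C i ^+ e * v); split.
- split.
  + by exists 0%N, 1; rewrite mul1g.
  + move=> _ _ [e [v [Dv ->]]] [f [w [Dw ->]]].
    exists (e + f)%N, (v * w); split; first exact: DM.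
    rewrite expgnDr -!mulgA; congr (_ * _); rewrite !mulgA; congr (_ * _).
    exact/commuteX/commute_sym/Dcomm.
  + move=> _ [e [v [Dv ->]]]; rewrite gmulfM gmulfXn => Cv1.
    suff Ce1 : C i ^+ e = 1.
      rewrite Ce1 mul1g; apply: D_inj => //.
      by move: Cv1; rewrite -gmulfXn Ce1 gmulf1 mul1g.
    case: (absC i) => [->|[Ci abs_i]]; first by rewrite expg1n.
    apply: ordC; rewrite Ci in Cv1; rewrite Ci; apply: (absolute_expg gS) => //.
    have -> : g i ^+ e = (pi v)^-1.
      by rewrite -[LHS](mulgK (pi v)) Cv1 mul1g.
    by rewrite groupV D_Gs.
- move=> _ [e [v [Dv ->]]].
  by rewrite gmulfM gmulfXn groupM ?groupX // sNH // D_Gs.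
- move=> j; rewrite leq_eqVlt => /orP[/eqP kj|lt_kj].
    by exists 1%N, 1; rewrite mulg1 expg1; split=> //; congr C; apply: val_inj.
  by exists 0%N, (C j); rewrite mul1g; split=> //; apply: DC.
- move=> _ j [e [v [Dv ->]]].
  by apply: commuteM; [apply: commuteX | apply: Dcomm].
Qed.

End PolycyclicSequence.

(** * Splitting of the extension *)

Theorem cp_extension_split (p n : nat) (g : 'I_n -> gT)
    (Gs : nat -> {group gT}) :
    prime p -> odd p -> p.-group [set: gT] -> (nil_class [set: gT] <= 3)%N ->
    pc_sequence [set: gT]%G g Gs ->
    (forall i j : 'I_n, (j < i)%N -> [~ g i, g j] != 1 ->
       exists2 k : 'I_n, [~ g i, g j] = g k & absolute g Gs k) ->
    (forall i j i' j' : 'I_n, (j < i)%N -> (j' < i')%N ->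
       [~ g i, g j] != 1 -> [~ g i', g j'] != 1 ->
       [~ g i, g j] = [~ g i', g j'] -> i = i' /\ j = j') ->
  exists2 s : gT -> E, cancel s pi & {morph s : a b / a * b}.
Proof.
move=> p_pr odd_p pG clG gS comm_abs comm_inj.
have L4 : 'L_4([set: gT]) = 1.
  exact/(lcn_nil_classP 3 (pgroup_nil pG)).
have tr3 (a b c d : gT) : commute [~ a, b, c] d.
  apply/commgP/eqP/set1P; rewrite -set1gE -L4.
  by rewrite !lcnSn !mem_commg ?finset.in_setT.
(* Three subgroups lemma: [[L_2, G, G] = L_4 = 1] forces [[G, G, L_2] = 1]. *)
have abG' : abelian [set: gT]^`(1).
  rewrite /abelian -lcn2; apply/commG1P/three_subgroup.
    by rewrite (commGC _ 'L_2(_)) -!lcnSn.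
  by rewrite -!lcnSn.
have commG' (a b c d : gT) : commute [~ a, b] [~ c, d].
  by apply: (centsP abG'); rewrite mem_commg ?finset.in_setT.
have odd_order (a : gT) : odd #[a].
  by apply: (@dvdn_odd _ #|[set: gT]|); rewrite ?order_dvdG ?finset.in_setT //;
     case/p_natP: (pG : p.-nat _) => e ->; rewrite oddX odd_p orbT.
have [t tK] := choice pi_surj.
pose is_comm (k i j : 'I_n) : Prop :=
  [/\ (j < i)%N, [~ g i, g j] != 1, [~ g i, g j] = g k & absolute g Gs k].
(* The chosen lift of [g k] is a commutator of lifts if [g k] is one of the given commutators; all
   other indices get the default value 1. *)
have ex_C (k : 'I_n) : exists c : E,
    (exists i j : 'I_n, is_comm k i j /\ c = [~ t (g i), t (g j)])
    \/ c = 1 /\ forall i j : 'I_n, ~ is_comm k i j.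
  have [[i [j ij]]|nij] := pselect (exists i j : 'I_n, is_comm k i j).
    by exists [~ t (g i), t (g j)]; left; exists i, j.
  by exists 1; right; split=> // i j ij; apply: nij; exists i, j.
have [C CP] := choice ex_C.
have [D psD DC] : exists2 D, partial_section D & forall k, D (C k).
  apply: (section_of_commuting gS).
  - move=> k l; apply: cpE.
    case: (CP k) => [[i [j [_ ->]]]|[-> _]]; last first.
      by rewrite gmulf1; apply/commute_sym/commute1.
    case: (CP l) => [[i' [j' [_ ->]]]|[-> _]]; last first.
      by rewrite gmulf1; apply/commute1.
    by rewrite !gmulfR.
  - move=> k; case: (CP k) => [[i [j [[_ _ gk abs_k] ->]]]|[-> _]].
      by right; rewrite gmulfR !tK.
    by left.
  - move=> k m; case: (CP k) => [[i [j [_ ->]]]|[-> _]]; last first.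
      by rewrite expg1n.
    set c := [~ t (g i), t (g j)] => cm.
    have : (#[pi c] %| m)%N by rewrite order_dvdn cm.
    case/dvdnP=> q ->; rewrite mulnC expgnA.
    suff -> : c ^+ #[pi c] = 1 by rewrite expg1n.
    apply: commg_order; rewrite ?odd_order //.
    by rewrite -gmulfR expg_order.
have [D1 DM D_inj] := psD.
have Dcomm u v : D [~ u, v].
  apply: (commg_generated gS) => // {u v}.
    by move=> u; apply: partial_sectionV.
  move=> i j u v lt_ji pu pv.
  have [cij|ncij] := eqVneq [~ g i, g j] 1.
    suff -> : [~ u, v] = 1 by [].
    by apply/eqP/commgP/cpE/commgP/eqP; rewrite pu pv.
  have [k gk abs_k] := comm_abs i j lt_ji ncij.
  suff -> : [~ u, v] = C k by [].
  case: (CP k) => [[i' [j' [[lt_ji' ncij' gk' _] ->]]]|[_ nk]]; last first.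
    by case: (nk i j).
  (* Distinctness of the commutators identifies [(i, j)] with the pair chosen for [k]; otherwise
     [[~ u, v]] and [C k] could differ by a kernel element. *)
  have [] := comm_inj i j i' j' lt_ji lt_ji' ncij ncij' _; first by rewrite gk.
  by move=> <- <-; apply: commg_lift; rewrite tK.
have [S [S1 SM S_inj] S_full] := full_section psD Dcomm.
have psS : partial_section S by [].
have ex_s (a : gT) : exists u, S u /\ pi u = a.
  by have [u] := S_full a; exists u.
have [s sP] := choice ex_s.
exists s => [a|a b]; first by case: (sP a).
have [[Sa pa] [Sb pb] [Sab pab]] := And3 (sP a) (sP b) (sP (a * b)).
(* The quotient of the two sides lies in [S] and maps to 1. *)
apply: mulgI (s (a * b))^-1 _ _ _; rewrite mulVg; apply/esym/S_inj.
  exact: SM (partial_sectionV psS Sab) (SM _ _ Sa Sb).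
by rewrite gmulfM gmulfV gmulfM pa pb pab mulVg.
Qed.

End CPExtension.

Import GRing.Theory.

(** * The central extension defined by a 2-cocycle *)

Section CocycleExtension.

Local Open Scope ring_scope.

Variables (gT : finGroupType) (M : zmodType).

(** The type is indexed by the cocycle so that each cocycle carries its own group structure on the
    pairs. *)
Definition cocycle_ext of Z2 gT M : Type := (gT * M)%type.

Variable f : Z2 gT M.
Local Notation E := (cocycle_ext f).
Local Notation F := (Z2val f).

HB.instance Definition _ := Choice.copy E (gT * M)%type.

(* f need not be normalized, hence the terms f (1, 1). *)
Definition ext_mul (u v : E) : E := ((u.1 * v.1)%g, u.2 + v.2 + F (u.1, v.1)).
Definition ext_one : E := (1%g, - F (1%g, 1%g)).
Definition ext_inv (u : E) : E :=
  (u.1^-1%g, - u.2 - F (u.1^-1%g, u.1) - F (1%g, 1%g)).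

Lemma cocycleE x y z :
  F (y, z) + F (x, (y * z)%g) = F (x, y) + F ((x * y)%g, z).
Proof.
apply/eqP; rewrite -subr_eq0; apply/eqP.
rewrite -[RHS](cocycle2P _ (Z2valP f) x y z) opprD addrA.
by rewrite (AC 4 (1*4*2*3))/=.
Qed.

Lemma cocycle1x x : F (1%g, x) = F (1%g, 1%g).
Proof. by have := cocycleE 1%g 1%g x; rewrite !mul1g => /addIr. Qed.

Lemma cocyclex1 x : F (x, 1%g) = F (1%g, 1%g).
Proof. by have := cocycleE x 1%g 1%g; rewrite !mulg1 => /addIr ->. Qed.

Lemma cocycleV x : F (x^-1%g, x) = F (x, x^-1%g).
Proof.
have := cocycleE x x^-1%g x.
by rewrite mulVg mulgV cocycle1x cocyclex1 => /addIr.
Qed.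

Fact ext_mulA : associative ext_mul.
Proof.
case=> x a [y b] [z c]; rewrite /ext_mul /= mulgA; congr (_, _).
rewrite -!addrA; congr (_ + (_ + _)).
by rewrite cocycleE addrCA.
Qed.

Fact ext_mul1g : left_id ext_one ext_mul.
Proof.
case=> x a; rewrite /ext_mul /ext_one /= mul1g (cocycle1x x).
by rewrite addrAC addNr add0r.
Qed.

Fact ext_mulg1 : right_id ext_one ext_mul.
Proof.
by case=> x a; rewrite /ext_mul /ext_one /= mulg1 (cocyclex1 x) subrK.
Qed.

Fact ext_mulVg : left_inverse ext_one ext_inv ext_mul.
Proof.
case=> x a; rewrite /ext_mul /ext_inv /ext_one /= mulVg; congr (_, _).
by rewrite (AC 5 ((1*4)*(2*5)*3))/= !addNr !add0r.
Qed.

Fact ext_mulgV : right_inverse ext_one ext_inv ext_mul.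
Proof.
case=> x a; rewrite /ext_mul /ext_inv /ext_one /= mulgV cocycleV.
by congr (_, _); rewrite (AC (1*3*1) ((1*2)*(3*5)*4))/= subrr addNr !add0r.
Qed.

HB.instance Definition _ :=
  isGroup.Build E ext_mulA ext_mul1g ext_mulg1 ext_mulVg ext_mulgV.

Definition ext_proj (u : E) : gT := u.1.

Fact ext_proj_morphism : monoid.monoid_morphism ext_proj.
Proof. by []. Qed.

HB.instance Definition _ :=
  isUMagmaMorphism.Build E gT ext_proj ext_proj_morphism.

Lemma ext_proj_surj a : exists u, ext_proj u = a.
Proof. by exists (a, 0). Qed.

Lemma ext_commute :
    (forall x y : gT, commute x y -> F (x, y) = F (y, x)) ->
  forall u v : E, commute (ext_proj u) (ext_proj v) -> commute u v.
Proof.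
move=> fC [x a] [y b] cxy; rewrite /commute.
by congr (_, _); rewrite /= ?(fC _ _ cxy) // (addrC a).
Qed.

Lemma ext_ker_divisible :
    (forall (a : M) m, (0 < m)%N -> exists b, b *+ m = a) ->
  forall (z : E) m, (0 < m)%N -> ext_proj z = 1%g ->
  exists2 d, ext_proj d = 1%g & (d ^+ m)%g = z.
Proof.
move=> divM [x a] m m_gt0; rewrite /ext_proj /= => ->.
(* The identity is [(1, - F (1, 1))], so the shift by [- F (1, 1)] turns addition in [M] into
   multiplication in the kernel. *)
have [b bm] := divM (a + F (1%g, 1%g)) m m_gt0.
pose d : E := (1%g, b - F (1%g, 1%g)).
have dX k : (d ^+ k)%g = (1%g, b *+ k - F (1%g, 1%g)).
  elim: k => [|k IHk]; first by rewrite mulr0n sub0r.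
  rewrite expgS IHk; congr (_, _); rewrite /= ?mulg1 // mulrS.
  by rewrite -(addrA (b - _)) subrK addrAC.
by exists d => //; rewrite dX bm addrK.
Qed.

(** Comparing second components in [s (a * b) = s a * s b] expresses [F (a, b)] as a coboundary. *)
Lemma section_coboundary (s : gT -> E) :
    cancel s ext_proj -> {morph s : a b / (a * b)%g} ->
  f \in @B2 gT M.
Proof.
move=> sK sM; apply/B2P; exists (fun a => - (s a).2).
have s1 a : (s a).1 = a by apply: sK.
apply/ffunP=> -[a b]; rewrite ffunE /= sM /= !s1 opprK.
by rewrite (AC (1*3*1) ((1*3)*(5*2)*4))/= !addNr !add0r.
Qed.

End CocycleExtension.

(** * Coefficients in Q/Z and the Bogomolov multiplier *)

Lemma QmodZ_divisible (a : QmodZ) m : (0 < m)%N ->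
  exists b : QmodZ, (b *+ m = a)%R.
Proof.
move=> m_gt0; exists (\pi_QmodZ (repr a / m%:R)%R)%qT.
rewrite -raddfMn /= -[(_ *+ m)%R]mulr_natr divfK ?reprK //.
by rewrite Num.Theory.pnatr_eq0 -lt0n.
Qed.

(** On the abelian subgroup generated by [x] and [y] the cocycle is a coboundary
    [h y - h (x * y) + h x], which is symmetric as [x * y = y * x]. *)
Lemma bogomolov_sym (gT : finGroupType) (c : H2 gT QmodZ) :
    bogomolov gT c ->
  forall x y : gT, commute x y -> Z2val (repr c) (x, y) = Z2val (repr c) (y, x).
Proof.
move=> Bc x y cxy; have abA : abelian <<[set x; y]>>.
  rewrite abelian_gen abelianE; apply/centsP.
  by move=> a /set2P[]-> b /set2P[]->.
have Ax : x \in <<[set x; y]>> by rewrite mem_gen // set21.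
have Ay : y \in <<[set x; y]>> by rewrite mem_gen // set22.
have := Bc <<[set x; y]>>%G abA; rewrite /= -[c in res2 _ c]reprK res2E.
move/eqP; rewrite -[X in _ == X](raddf0 (\pi_(H2 _ _)%qT)) -Quotient.idealrBE.
rewrite subr0 => /B2P[h /ffunP hE].
have := hE (subg _ x, subg _ y); have := hE (subg _ y, subg _ x).
rewrite !ffunE /= !subgK // => -> ->.
have -> : (subg <<[set x; y]>> x * subg <<[set x; y]>> y
           = subg <<[set x; y]>> y * subg <<[set x; y]>> x)%g.
  by apply: val_inj; rewrite /= !subgK.
by rewrite addrAC [RHS]addrAC; congr (_ - _)%R; apply: addrC.
Qed.

Theorem proposition3p2 (p : nat) (gT : finGroupType) (n : nat)
    (g : 'I_n -> gT) (Gs : nat -> {group gT})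
    (p_prime : prime p) (p_gt3 : (3 < p)%N)
    (pG : p.-group [set: gT]) (clG : (nil_class [set: gT] <= 3)%N)
    (gS : pc_sequence [set: gT]%G g Gs)
    (comm_absolute : forall i j : 'I_n, (j < i)%N -> [~ g i, g j] != 1 ->
       exists2 k : 'I_n, [~ g i, g j] = g k & absolute g Gs k)
    (comm_inj : forall i j i' j' : 'I_n, (j < i)%N -> (j' < i')%N ->
       [~ g i, g j] != 1 -> [~ g i', g j'] != 1 ->
       [~ g i, g j] = [~ g i', g j'] -> i = i' /\ j = j') :
  bogomolov gT = [set 0%R]%classic.
Proof.
have odd_p : odd p by case: (even_prime p_prime) p_gt3 => [->|].
apply/seteqP; split=> [c Bc|_ -> A abA]; last exact: raddf0.
rewrite /= -[c]reprK; apply/eqP.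
rewrite -[X in _ == X](raddf0 (\pi_(H2 gT QmodZ)%qT)) -Quotient.idealrBE subr0.
have [s sK sM] := cp_extension_split (pi := @ext_proj _ _ (repr c))
  (@ext_proj_surj _ _ _) (ext_commute (bogomolov_sym Bc))
  (ext_ker_divisible QmodZ_divisible) p_prime odd_p pG clG gS comm_absolute
  comm_inj.
exact: section_coboundary sK sM.
Qed.
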